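(* Let $G$ be a $2t$-regular graph of order $n$ that admits a neighborhood balanced coloring and that admits a local distance antimagic labeling, and let $H$ be an $r$-regular graph of order $m$. Then $\chi_{ld}(G\times H)\leq \chi_{ld}(G)$.
   Context: All graphs are finite, simple, undirected and without isolated vertices. For a graph $G$ of order $n$ and a bijection $f\colon V(G)\to\{1,2,\dots,n\}$, the weight of a vertex $u$ is $w_f(u)=\sum_{x\in N(u)}f(x)$, where $N(u)$ is the open neighborhood of $u$. The bijection $f$ is a local distance antimagic labeling of $G$ if $w_f(u)\neq w_f(v)$ for every edge $uv$ of $G$. The local distance antimagic chromatic number $\chi_{ld}(G)$ is the minimum number of distinct weights over all local distance antimagic labelings of $G$ (an upper bound on $\chi_{ld}$ includes the assertion that such a labeling exists). A neighborhood balanced coloring of a graph is an assignment of one of two colors to each vertex (not necessarily proper) such that every vertex has equally many neighbors of each color. The direct product $G\times H$ has vertex set $V(G)\times V(H)$, with $(g,h)$ and $(g',h')$ adjacent iff $gg'\in E(G)$ and $hh'\in E(H)$. *)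

(* Defs.v *)
From mathcomp Require Import all_boot.

Set Implicit Arguments.
Unset Strict Implicit.
Unset Printing Implicit Defensive.

Record sgraph := SGraph {
  vertex :> finType;
  adj : rel vertex;
  adj_sym : symmetric adj;
  adj_irrefl : irreflexive adj
}.

Definition nbhd (G : sgraph) (u : G) : {set G} := [set x | adj u x].

Definition no_isolated (G : sgraph) : Prop := forall u : G, nbhd u != set0.

Definition regular (d : nat) (G : sgraph) : Prop := forall u : G, #|nbhd u| = d.

Definition nbhd_balanced_coloring (G : sgraph) (c : G -> bool) : Prop :=
  forall u : G, #|[set x in nbhd u | c x]| = #|[set x in nbhd u | ~~ c x]|.

Definition nbhd_balanced (G : sgraph) : Prop :=
  exists c : G -> bool, nbhd_balanced_coloring c.

(* A labeling by {1, ..., n} is encoded as a map to 'I_n = {0, ..., n - 1},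
   the label of x being (f x).+1. *)
Definition weight (G : sgraph) (f : {ffun G -> 'I_#|G|}) (u : G) : nat :=
  \sum_(x in nbhd u) (f x).+1.

Definition ld_antimagic (G : sgraph) (f : {ffun G -> 'I_#|G|}) : bool :=
  [&& injectiveb f, [forall i, i \in codom f] &
      [forall u, forall v, adj u v ==> (weight f u != weight f v)]].

Definition num_weights (G : sgraph) (f : {ffun G -> 'I_#|G|}) : nat :=
  size (undup [seq weight f u | u : G]).

Definition has_ld_antimagic (G : sgraph) : Prop :=
  exists f : {ffun G -> 'I_#|G|}, ld_antimagic f.

Definition attained (G : sgraph) (k : nat) : bool :=
  [exists f : {ffun G -> 'I_#|G|}, ld_antimagic f && (num_weights f == k)].

Lemma attained_ex (G : sgraph) : has_ld_antimagic G -> exists k, attained G k.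
Proof.
by case=> f Hf; exists (num_weights f); apply/existsP; exists f; rewrite Hf /=.
Qed.

(* Only defined for graphs that have a labeling; the value does not depend on
   the existence proof. *)
Definition chi_ld (G : sgraph) (hG : has_ld_antimagic G) : nat :=
  ex_minn (attained_ex hG).

Section DirectProduct.
Variables G H : sgraph.

Definition dprod_adj : rel (G * H) :=
  fun u v => adj u.1 v.1 && adj u.2 v.2.

Lemma dprod_adj_sym : symmetric dprod_adj.
Proof. by move=> u v; rewrite /dprod_adj adj_sym [adj u.2 _]adj_sym. Qed.

Lemma dprod_adj_irrefl : irreflexive dprod_adj.
Proof. by move=> u; rewrite /dprod_adj adj_irrefl. Qed.

Definition direct_product : sgraph := SGraph dprod_adj_sym dprod_adj_irrefl.

End DirectProduct.

(* Main.v *)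
Require Import Defs.
From mathcomp Require Import all_boot zify.

(** Let c be a neighborhood balanced coloring of G and f a labeling of G. Number
    the vertices of H by j = 0, ..., m-1 and, with labels counted from 0, label
    (g, h_j) by m * f(g) + j or m * f(g) + (m-1-j), according to the color c(g).
    Over the neighbors of g the two colors occur t times each, so the terms
    depending on j cancel and the weight of (g, h) is an affine function of the
    weight of g, of slope r * m > 0 as soon as the product has an edge. *)

Set Implicit Arguments.
Unset Strict Implicit.
Unset Printing Implicit Defensive.

Lemma card_balanced_nbhd (G : sgraph) (t : nat) (c : G -> bool) (u : G) :
  regular (2 * t) G -> nbhd_balanced_coloring c ->
  #|[set x in nbhd u | c x]| = t /\ #|[set x in nbhd u | ~~ c x]| = t.
Proof.
move=> Greg cbal; have := cbal u; have := Greg u.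
rewrite -(cardsID [set x | c x]).
have -> : nbhd u :&: [set x | c x] = [set x in nbhd u | c x].
  by apply/setP=> x; rewrite !inE.
have -> : nbhd u :\: [set x | c x] = [set x in nbhd u | ~~ c x].
  by apply/setP=> x; rewrite !inE andbC.
lia.
Qed.

Lemma sum_balanced_nbhd (G : sgraph) (t : nat) (c : G -> bool) (u : G)
    (a b : nat) :
  regular (2 * t) G -> nbhd_balanced_coloring c ->
  \sum_(x in nbhd u) (if c x then a else b) = t * (a + b).
Proof.
move=> Greg cbal; have [ct cf] := card_balanced_nbhd u Greg cbal.
rewrite (bigID c) /= mulnDr; congr (_ + _).
  rewrite (eq_bigr (fun=> a)) => [|x /andP[_ ->] //].
  rewrite -[in RHS]ct -sum_nat_const; apply: eq_bigl => x.
  by rewrite !inE.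
rewrite (eq_bigr (fun=> b)) => [|x /andP[_ /negPf-> //]].
rewrite -[in RHS]cf -sum_nat_const; apply: eq_bigl => x.
by rewrite !inE.
Qed.

Section ProductLabeling.
Variables (G H : sgraph) (c : G -> bool) (f : {ffun G -> 'I_#|G|}).

Definition twist (b : bool) (h : H) : 'I_#|H| :=
  if b then enum_rank h else rev_ord (enum_rank h).

(** Counted from 1, the two values at [h] sum to [#|H|.+1] for every [h]; this is where the
    dependence on the numbering of [H] cancels. *)
Lemma twistE (b : bool) (h : H) :
  (twist b h).+1 = if b then (enum_rank h).+1 else #|H| - enum_rank h.
Proof. by case: b; rewrite //= subnSK. Qed.

Lemma twist_inj (b : bool) : injective (twist b).
Proof.
by case: b => h h'; [apply: enum_rank_inj | move/rev_ord_inj/enum_rank_inj].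
Qed.

Lemma product_label_lt (u : direct_product G H) :
  f u.1 * #|H| + twist (c u.1) u.2 < #|direct_product G H|.
Proof.
rewrite (card_prod G H); have := ltn_ord (f u.1).
have := ltn_ord (twist (c u.1) u.2); nia.
Qed.

Definition product_label : {ffun direct_product G H -> 'I_#|direct_product G H|} :=
  [ffun u => Ordinal (product_label_lt u)].

Lemma product_label_inj : injective f -> injective product_label.
Proof.
move=> finj [g h] [g' h']; rewrite !ffunE => /(congr1 val) /= E.
have lt1 := ltn_ord (twist (c g) h); have lt2 := ltn_ord (twist (c g') h').
have m_gt0 : 0 < #|H| by exact: leq_ltn_trans lt1.
have fE : f g = f g' :> nat.
  (* The twist is a remainder below [#|H|], so Euclidean division recovers [f g]. Then [g], hence
     the color, is known, and a single twist has to be inverted. *)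
  by have := congr1 (divn^~ #|H|) E; rewrite !divnMDl // !divn_small // !addn0.
have gE : g = g' by apply/finj/val_inj.
subst g'; congr (_, _).
by apply: (@twist_inj (c g)); apply: val_inj; apply: (addnI E).
Qed.

(** The term added on the left avoids subtraction in [nat]: [weight f] uses [(f g).+1], which costs
    an extra [#|H|] at each of the [r * (2 * t)] neighbors. *)
Lemma weight_product_label (t r : nat) (u : direct_product G H) :
  regular (2 * t) G -> regular r H -> nbhd_balanced_coloring c ->
  weight product_label u + r * (2 * t * #|H|) =
  r * (#|H| * weight f u.1 + t * #|H|.+1).
Proof.
move=> Greg Hreg cbal.
have -> : weight product_label u =
    \sum_(g in nbhd u.1) \sum_(h in nbhd u.2)
      (#|H| * f g + twist (c g) h).+1.
  rewrite /weight pair_big /=.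
  by apply: eq_big => [v|v _]; rewrite ?inE // ffunE /= mulnC.
(* Balance acts on neighbors in [G], so [h] is fixed outside. The factors [r] and [2 * t] are then
   turned into sums over neighborhoods, and the comparison is termwise. *)
rewrite exchange_big /=.
rewrite -(Hreg u.2) -!(sum_nat_const (mem (nbhd u.2))) -big_split /=.
apply: eq_bigr => h _.
rewrite -(Greg u.1) -(sum_nat_const (mem (nbhd u.1))) -big_split /= /weight
  big_distrr /=.
have -> : #|H|.+1 = (enum_rank h).+1 + (#|H| - enum_rank h).
  by rewrite addSn subnKC // ltnW // ltn_ord.
rewrite -(sum_balanced_nbhd u.1 _ _ Greg cbal) -big_split /=.
by apply: eq_bigr => g _; rewrite -twistE mulnS addnC addnS addnA addnS.
Qed.

Lemma product_label_ld_antimagic (t r : nat) :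
  no_isolated H -> regular (2 * t) G -> regular r H ->
  nbhd_balanced_coloring c -> ld_antimagic f -> ld_antimagic product_label.
Proof.
move=> Hiso Greg Hreg cbal /and3P[/injectiveP finj _ /forallP fld].
have linj := product_label_inj finj.
apply/and3P; split; first exact/injectiveP.
  by apply/forallP=> i; apply: inj_card_onto; rewrite // card_ord.
apply/forallP=> u; apply/forallP=> v; apply/implyP=> /andP[uv1 _].
have := forallP (fld u.1) v.1; rewrite uv1 /=; apply: contraNneq => E.
have Eu := weight_product_label u Greg Hreg cbal.
have Ev := weight_product_label v Greg Hreg cbal.
(* Positivity of [r] and [#|H|] makes the affine map injective, so equal weights in the product
   descend to [G]. *)
have r_gt0 : 0 < r by rewrite -(Hreg u.2) card_gt0.
have m_gt0 : 0 < #|H| by apply/card_gt0P; exists u.2.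
move: Eu; rewrite E Ev => /eqP.
by rewrite eqn_pmul2l // eqn_add2r eqn_pmul2l // eq_sym.
Qed.

Lemma num_weights_product_label (t r : nat) :
  regular (2 * t) G -> regular r H -> nbhd_balanced_coloring c ->
  num_weights product_label <= num_weights f.
Proof.
move=> Greg Hreg cbal; rewrite /num_weights.
(* The affine map solved for the product weight. Truncation is harmless: at a weight of [f], the
   minuend is the product weight plus the subtrahend. *)
pose phi w := r * (#|H| * w + t * #|H|.+1) - r * (2 * t * #|H|).
rewrite -(size_map phi (undup [seq weight f v | v : G])).
apply: uniq_leq_size => [|w].
  exact: undup_uniq.
rewrite mem_undup => /imageP[u _ ->].
apply/mapP; exists (weight f u.1); first by rewrite mem_undup image_f.
by rewrite /phi -(weight_product_label u Greg Hreg cbal) addnK.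
Qed.

End ProductLabeling.

Lemma chi_ld_le_num_weights (G : sgraph) (hG : has_ld_antimagic G)
    (f : {ffun G -> 'I_#|G|}) :
  ld_antimagic f -> chi_ld hG <= num_weights f.
Proof.
move=> f_ld; rewrite /chi_ld; case: ex_minnP => k _; apply.
by apply/existsP; exists f; rewrite f_ld eqxx.
Qed.

Lemma chi_ld_attained (G : sgraph) (hG : has_ld_antimagic G) :
  exists2 f : {ffun G -> 'I_#|G|}, ld_antimagic f & num_weights f = chi_ld hG.
Proof.
rewrite /chi_ld; case: ex_minnP => k /existsP[f /andP[f_ld /eqP fk]] _.
by exists f.
Qed.

Theorem theorem5p1 (n m t r : nat) (G H : sgraph)
  (G_noiso : no_isolated G) (H_noiso : no_isolated H)
  (G_order : #|G| = n) (H_order : #|H| = m)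
  (G_reg : regular (2 * t) G) (H_reg : regular r H)
  (G_balanced : nbhd_balanced G) (G_ld : has_ld_antimagic G) :
  exists GH_ld : has_ld_antimagic (direct_product G H),
    chi_ld GH_ld <= chi_ld G_ld.
Proof.
have [c cbal] := G_balanced; have [f f_ld <-] := chi_ld_attained G_ld.
have l_ld := product_label_ld_antimagic H_noiso G_reg H_reg cbal f_ld.
have GH_ld : has_ld_antimagic (direct_product G H).
  by exists (product_label H c f).
exists GH_ld; apply: leq_trans (chi_ld_le_num_weights GH_ld l_ld) _.
exact: num_weights_product_label G_reg H_reg cbal.
Qed.
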